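(* Let $\mathcal{H}_1,\mathcal{H}_2$ be right quaternionic Hilbert spaces, $K_1 \in \mathbb{B}(\mathcal{H}_1)$ and $K_2 \in \mathbb{B}(\mathcal{H}_2)$. Let $\{ u_i \}_{i \in I}$ be a $K_1$-frame for $\mathcal{H}_1$ and $\{ v_i \}_{i \in I}$ be a $K_2$-frame for $\mathcal{H}_2$. Let $\theta_1$ and $\theta_2$ be the frame transforms of $\{ u_i \}_{i \in I}$ and $\{ v_i \}_{i \in I}$ respectively. If $R(\theta_1) \perp R(\theta_2)$ in $\ell^2(\mathbb{H})$, then $\{ u_i \oplus v_i \}_{i \in I}$ is a $K_1 \oplus K_2$-frame for $\mathcal{H}_1 \oplus \mathcal{H}_2$.
   Context: $\mathbb{H}$ denotes the skew field of quaternions. A right quaternionic Hilbert space is a right $\mathbb{H}$-vector space with an inner product $\langle\cdot,\cdot\rangle$ valued in $\mathbb{H}$ satisfying $\langle u,v\rangle=\overline{\langle v,u\rangle}$, $\langle u,u\rangle>0$ for $u\neq 0$, additivity in the second variable and $\langle u,vq\rangle=\langle u,v\rangle q$ for $q\in\mathbb{H}$, complete for the norm $\|u\|=\sqrt{\langle u,u\rangle}$. $\mathbb{B}(\mathcal{H})$ is the set of bounded right $\mathbb{H}$-linear operators on $\mathcal{H}$; $L^*$ is the adjoint and $R(L)$ the range of $L$. $I$ is a countable index set, and $\ell^2(\mathbb{H})=\{\{q_i\}_{i\in I}\subset\mathbb{H}:\sum_{i\in I}|q_i|^2<\infty\}$ with $\langle p,q\rangle=\sum_{i\in I}\overline{p_i}q_i$.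 The direct sum $\mathcal{H}_1\oplus\mathcal{H}_2$ carries the inner product $\langle u_1\oplus v_1,u_2\oplus v_2\rangle=\langle u_1,u_2\rangle+\langle v_1,v_2\rangle$ and is a right quaternionic Hilbert space. $K_1\oplus K_2$ is the operator $(K_1\oplus K_2)(u\oplus v)=K_1u\oplus K_2v$. For $K\in\mathbb{B}(\mathcal{H})$, a sequence $\{w_i\}_{i\in I}$ in $\mathcal{H}$ is a $K$-frame for $\mathcal{H}$ if there are $0<A\le B<\infty$ with $A\|K^*u\|^2\le\sum_{i\in I}|\langle w_i,u\rangle|^2\le B\|u\|^2$ for all $u\in\mathcal{H}$. The frame transform of such a sequence is the operator $\theta:\mathcal{H}\to\ell^2(\mathbb{H})$, $\theta u=\{\langle w_i,u\rangle\}_{i\in I}$. *)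

(* Defs.v *)
From HB Require Import structures.
From mathcomp Require Import all_boot all_order all_algebra.
From mathcomp Require Import finmap.
From mathcomp Require Import boolp classical_sets functions cardinality fsbigop.
From mathcomp Require Import reals ereal topology normedtype sequences esum.
From mathcomp.analysis.showcase Require summability.
From mathcomp Require Import ring lra.

Set Implicit Arguments.
Unset Strict Implicit.
Unset Printing Implicit Defensive.

Import Order.TTheory GRing.Theory Num.Theory numFieldNormedType.Exports.

Local Open Scope classical_set_scope.
Local Open Scope ring_scope.

(* Quat a b c d is a + b i + c j + d k. *)
Record quat (R : realType) := Quat { qre : R; qi : R; qj : R; qk : R }.

Section QuatRing.
Variable R : realType.
Implicit Types p q : quat R.

Definition quat_tuple p := (qre p, qi p, qj p, qk p).
Definition tuple_quat (t : R * R * R * R) : quat R :=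
  let: (a, b, c, d) := t in Quat a b c d.
Lemma quat_tupleK : cancel quat_tuple tuple_quat. Proof. by case. Qed.

HB.instance Definition _ := Choice.copy (quat R) (can_type quat_tupleK).

Lemma quat_eq p q :
  qre p = qre q -> qi p = qi q -> qj p = qj q -> qk p = qk q -> p = q.
Proof. by case: p q => [? ? ? ?] [? ? ? ?] /= -> -> -> ->. Qed.

Definition qzero : quat R := Quat 0 0 0 0.
Definition qone : quat R := Quat 1 0 0 0.
Definition qopp p := Quat (- qre p) (- qi p) (- qj p) (- qk p).
Definition qadd p q :=
  Quat (qre p + qre q) (qi p + qi q) (qj p + qj q) (qk p + qk q).
Definition qmul p q := Quat
  (qre p * qre q - qi p * qi q - qj p * qj q - qk p * qk q)
  (qre p * qi q + qi p * qre q + qj p * qk q - qk p * qj q)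
  (qre p * qj q - qi p * qk q + qj p * qre q + qk p * qi q)
  (qre p * qk q + qi p * qj q - qj p * qi q + qk p * qre q).

Lemma qaddA : associative qadd.
Proof. by move=> p q r; apply: quat_eq; rewrite /= addrA. Qed.
Lemma qaddC : commutative qadd.
Proof. by move=> p q; apply: quat_eq; rewrite /= addrC. Qed.
Lemma qadd0q : left_id qzero qadd.
Proof. by move=> p; apply: quat_eq; rewrite /= add0r. Qed.
Lemma qaddNq : left_inverse qzero qopp qadd.
Proof. by move=> p; apply: quat_eq; rewrite /= addNr. Qed.
HB.instance Definition _ := GRing.isZmodule.Build (quat R)
  qaddA qaddC qadd0q qaddNq.

Lemma qmulA : associative qmul.
Proof. by move=> p q r; apply: quat_eq => /=; ring. Qed.
Lemma qmul1q : left_id qone qmul.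
Proof. by move=> p; apply: quat_eq => /=; ring. Qed.
Lemma qmulq1 : right_id qone qmul.
Proof. by move=> p; apply: quat_eq => /=; ring. Qed.
Lemma qmulDl : left_distributive qmul +%R.
Proof. by move=> p q r; apply: quat_eq => /=; ring. Qed.
Lemma qmulDr : right_distributive qmul +%R.
Proof. by move=> p q r; apply: quat_eq => /=; ring. Qed.
Lemma qone_neq0 : qone != 0.
Proof. by apply/eqP => -[] /eqP; rewrite oner_eq0. Qed.
HB.instance Definition _ := GRing.Zmodule_isNzRing.Build (quat R)
  qmulA qmul1q qmulq1 qmulDl qmulDr qone_neq0.

Definition qconj q := Quat (qre q) (- qi q) (- qj q) (- qk q).
Definition qabs q :=
  Num.sqrt (qre q ^+ 2 + qi q ^+ 2 + qj q ^+ 2 + qk q ^+ 2).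

Lemma qabs_sqr q :
  qabs q ^+ 2 = qre q ^+ 2 + qi q ^+ 2 + qj q ^+ 2 + qk q ^+ 2.
Proof. by rewrite sqr_sqrtr// !addr_ge0 ?sqr_ge0. Qed.

Definition qinv q : quat R :=
  let n := qabs q ^+ 2 in
  Quat (qre q / n) (- qi q / n) (- qj q / n) (- qk q / n).

Lemma qabs_neq0 q : q != 0 -> qabs q ^+ 2 != 0.
Proof.
apply: contra; rewrite qabs_sqr.
have sq (x : R) := sqr_ge0 x.
rewrite !paddr_eq0 ?addr_ge0 ?sq// !sqrf_eq0.
move=> /andP[/andP[/andP[/eqP a /eqP b] /eqP c] /eqP d].
by apply/eqP; apply: quat_eq.
Qed.

Lemma qmulVq : {in [pred q : quat R | q != 0], left_inverse 1 qinv *%R}.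
Proof.
move=> q /qabs_neq0 q0; apply: quat_eq => /=;
  by move: q0; rewrite /= qabs_sqr => q0; field.
Qed.
Lemma qmulqV : {in [pred q : quat R | q != 0], right_inverse 1 qinv *%R}.
Proof.
move=> q /qabs_neq0 q0; apply: quat_eq => /=;
  by move: q0; rewrite /= qabs_sqr => q0; field.
Qed.
Lemma qunitP p q : q * p = 1 /\ p * q = 1 -> p != 0.
Proof.
by move=> [+ _]; apply: contra_eqN => /eqP ->; rewrite mulr0 eq_sym oner_eq0.
Qed.
Lemma qinv0 : {in [predC [pred q : quat R | q != 0]], qinv =1 id}.
Proof.
by move=> q; rewrite inE negbK => /eqP ->; apply: quat_eq; rewrite /= ?oppr0 mul0r.
Qed.
HB.instance Definition _ := GRing.NzRing_hasMulInverse.Build (quat R)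
  qmulVq qmulqV qunitP qinv0.

Lemma qreD p q : qre (p + q) = qre p + qre q. Proof. by []. Qed.
Lemma qreN p : qre (- p) = - qre p. Proof. by []. Qed.
Lemma qconjK : involutive qconj.
Proof. by move=> q; apply: quat_eq; rewrite /= ?opprK. Qed.
Lemma qconjD p q : qconj (p + q) = qconj p + qconj q.
Proof. by apply: quat_eq => /=; ring. Qed.
Lemma qconjM p q : qconj (p * q) = qconj q * qconj p.
Proof. by apply: quat_eq => /=; ring. Qed.

Lemma qre_sep p q : (forall r, qre (p * r) = qre (q * r)) -> p = q.
Proof.
move=> h.
have := h (Quat 1 0 0 0); have := h (Quat 0 1 0 0).
have := h (Quat 0 0 1 0); have := h (Quat 0 0 0 1).
rewrite /= => h1 h2 h3 h4; apply: quat_eq; lra.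
Qed.
End QuatRing.

(* A right quaternionic vector space is a left module over the converse ring;
   (v q) is q *: v with q seen in (quat R)^c. *)
Definition rscale (R : realType) (V : lmodType (quat R)^c) (v : V)
  (q : quat R) : V := (q : (quat R)^c) *: v.

(* <u, u> is a real quaternion by conjugate symmetry, so that its positivity is
   that of its real part. *)
Definition ip_norm (R : realType) (V : Type) (ip : V -> V -> quat R) (u : V) : R :=
  Num.sqrt (qre (ip u u)).

HB.mixin Record isRQHilbert (R : realType) V of GRing.Lmodule (quat R)^c V := {
  inner : V -> V -> quat R;
  inner_conj : forall u v, inner u v = qconj (inner v u);
  inner_gt0 : forall u, u != 0 -> 0 < qre (inner u u);
  innerDr : forall u v w, inner u (v + w) = inner u v + inner u w;
  innerZr : forall u v q, inner u (rscale v q) = inner u v * q;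
  inner_complete : forall x : nat -> V,
    (forall e : R, 0 < e -> exists N : nat, forall m n : nat,
       (N <= m)%N -> (N <= n)%N -> ip_norm inner (x m - x n) < e) ->
    exists l : V, forall e : R, 0 < e -> exists N : nat, forall n : nat,
       (N <= n)%N -> ip_norm inner (x n - l) < e
}.

#[short(type="rqHilbertType")]
HB.structure Definition RQHilbert (R : realType) :=
  { V of isRQHilbert R V & GRing.Lmodule (quat R)^c V }.

Definition hnorm (R : realType) (H : rqHilbertType R) (u : H) : R :=
  ip_norm inner u.

Section InnerTheory.
Variables (R : realType) (H : rqHilbertType R).
Implicit Types u v w : H.

Let b u v : R := qre (inner u v).

Lemma inner0r u : inner u 0 = 0.
Proof.
have := innerDr u 0 0; rewrite addr0 => h.
by apply: (@addrI _ (inner u 0)); rewrite addr0 -h.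
Qed.

Lemma innerNr u v : inner u (- v) = - inner u v.
Proof.
by apply: (@addrI _ (inner u v)); rewrite -innerDr !subrr inner0r.
Qed.

Lemma innerDl u v w : inner (u + v) w = inner u w + inner v w.
Proof. by rewrite inner_conj innerDr qconjD -!inner_conj. Qed.

Lemma innerNl u v : inner (- u) v = - inner u v.
Proof.
by apply: (@addrI _ (inner u v)); rewrite -innerDl !subrr inner_conj inner0r;
   apply: quat_eq; rewrite /= ?oppr0.
Qed.

Lemma innerZl u v q : inner (rscale u q) v = qconj q * inner u v.
Proof. by rewrite inner_conj innerZr qconjM -inner_conj. Qed.

Lemma reC u v : b u v = b v u.
Proof. by rewrite /b inner_conj. Qed.

Lemma reDr u v w : b u (v + w) = b u v + b u w.
Proof. by rewrite /b innerDr. Qed.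

Lemma reDl u v w : b (u + v) w = b u w + b v w.
Proof. by rewrite /b innerDl. Qed.

Lemma reNr u v : b u (- v) = - b u v.
Proof. by rewrite /b innerNr. Qed.

Lemma reZr u v (t : R) : b u (rscale v (Quat t 0 0 0)) = t * b u v.
Proof. by rewrite /b innerZr /=; ring. Qed.

Lemma re_ge0 u : 0 <= b u u.
Proof.
have [->|u0] := eqVneq u 0; first by rewrite /b inner0r.
exact/ltW/inner_gt0.
Qed.

Lemma hnorm_ge0 u : 0 <= hnorm u. Proof. exact: sqrtr_ge0. Qed.

Lemma hnorm_sqr u : hnorm u ^+ 2 = qre (inner u u).
Proof. exact/sqr_sqrtr/re_ge0. Qed.

Lemma inner_sep u : (forall v, inner u v = 0) -> u = 0.
Proof.
move=> h; apply/eqP; apply: contraT => /inner_gt0.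
by rewrite h ltxx.
Qed.

Lemma reCS u v : b u v ^+ 2 <= b u u * b v v.
Proof.
have [->|v0] := eqVneq v 0; first by rewrite /b !inner0r /=; nra.
have nv : 0 < b v v by exact: inner_gt0.
have := re_ge0 (u + rscale v (Quat (- (b u v / b v v)) 0 0 0)).
rewrite reDl !reDr reZr (reC (rscale _ _) u) !reZr (reC (rscale _ _) v) reZr.
have -> x y z : 0 < z ->
  x + - (y / z) * y + (- (y / z) * y + - (y / z) * (- (y / z) * z)) =
  (x * z - y ^+ 2) / z :> R by move=> z0; field; rewrite gt_eqF.
  by rewrite pmulr_lge0 ?invr_gt0// subr_ge0.
by [].
Qed.

Lemma re_le_norm u v : `|b u v| <= hnorm u * hnorm v.
Proof.
rewrite -ler_sqr ?nnegrE ?mulr_ge0 ?hnorm_ge0//.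
by rewrite real_normK ?num_real// exprMn !hnorm_sqr; exact: reCS.
Qed.

End InnerTheory.

Definition bounded_op (R : realType) (H1 H2 : rqHilbertType R) (L : H1 -> H2) :=
  exists C : R, forall u, hnorm (L u) <= C * hnorm u.

(* The linear structure is over (quat R)^c, so op_fun is right linear. *)
Record bop (R : realType) (H : rqHilbertType R) := Bop {
  op_fun :> {linear H -> H};
  op_bounded : bounded_op op_fun
}.

Section Riesz.
Variables (R : realType) (H : rqHilbertType R) (phi : H -> quat R).
Hypothesis phiD : forall u v, phi (u + v) = phi u + phi v.
Hypothesis phiZ : forall u q, phi (rscale u q) = phi u * q.
Variable C : R.
Hypothesis phiC : forall u, `|qre (phi u)| <= C * hnorm u.

Let b (u v : H) : R := qre (inner u v).
Let r (u : H) : R := qre (phi u).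
Let J (u : H) : R := b u u - 2 * r u.

Let rZ u (t : R) : r (rscale u (Quat t 0 0 0)) = t * r u.
Proof. by rewrite /r phiZ /=; ring. Qed.

Let J_lb u : - C ^+ 2 <= J u.
Proof.
have := phiC u; rewrite ler_norml => /andP[_ h].
rewrite /J /b /r -hnorm_sqr; move: h; set n := hnorm u; set x := qre _ => h.
by have := sqr_ge0 (n - C); nra.
Qed.

Let JE u z t : J (u + rscale z (Quat t 0 0 0)) =
  J u + t ^+ 2 * b z z + 2 * t * (b u z - r z).
Proof.
rewrite /J /r phiD qreD -/(r _) -/(r _) rZ /b reDl !reDr reZr.
rewrite (reC (rscale _ _) u) !reZr (reC (rscale _ _) z) reZr -/(r z); ring.
Qed.

Let m := inf [set J u | u in setT].

Let m_le u : m <= J u.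
Proof.
apply: ge_inf; last by exists u.
by exists (- C ^+ 2) => _ [w _ <-]; exact: J_lb.
Qed.

Let approx (k : nat) : exists u, J u < m + k.+1%:R^-1.
Proof.
have [||_ [u _ <-] hu] := @inf_adherent _ [set J u | u in setT] k.+1%:R^-1.
- by rewrite invr_gt0.
- split; first by exists (J 0); exists 0.
  by exists (- C ^+ 2) => _ [w _ <-]; exact: J_lb.
- by exists u.
Qed.

Let x k := sval (cid (approx k)).
Let xP k : J (x k) < m + k.+1%:R^-1. Proof. exact: (svalP (cid (approx k))). Qed.

Let near_opt u z d : 0 <= d -> J u <= m + d -> (b u z - r z) ^+ 2 <= d * b z z.
Proof.
move=> d0 Ju; have [->|z0] := eqVneq z 0.
  have r0 : r 0 = 0.
    by apply: (@addrI _ (r 0)); rewrite -qreD -phiD !addr0.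
  by rewrite /b !inner0r r0 /=; nra.
have nz : 0 < b z z by exact: inner_gt0.
set c := b u z - r z.
have := m_le (u + rscale z (Quat (- (c / b z z)) 0 0 0)).
rewrite JE -/c => h.
have e : (- (c / b z z)) ^+ 2 * b z z + 2 * - (c / b z z) * c = - (c ^+ 2 / b z z).
  by field; rewrite gt_eqF.
have : c ^+ 2 / b z z <= d by lra.
by rewrite ler_pdivrMr.
Qed.

Let x_cauchy d u v : 0 <= d -> J u <= m + d -> J v <= m + d ->
  b (u - v) (u - v) <= 4 * d.
Proof.
move=> d0 Ju Jv.
have := near_opt (v - u) d0 Ju; have := near_opt (u - v) d0 Jv.
set z := u - v.
have zN : v - u = - z by rewrite opprB.
have rN : r (- z) = - r z.
  have h : r (z - z) = r z + r (- z) by rewrite /r phiD.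
  have h0 : r (0 : H) = 0.
    by apply: (@addrI _ (r 0)); rewrite -qreD -phiD !addr0.
  by rewrite subrr h0 in h; lra.
have zz : b (- z) (- z) = b z z by rewrite /b reNr reC reNr opprK.
have uz : b u z = b v z + b z z by rewrite /b -reDl addrC subrK.
have bN : b u (- z) = - b u z by exact: reNr.
rewrite zN zz rN bN uz => h1 h2.
have n0 : 0 <= b z z by exact: re_ge0.
set s := b v z - r z in h1.
have h3 : (s + b z z) ^+ 2 <= d * b z z.
  by apply: le_trans h2; rewrite le_eqVlt; apply/orP; left; apply/eqP; rewrite /s; ring.
have [zle|zgt] := lerP (b z z) 0; first by nra.
rewrite -(ler_pM2r zgt).
by have := sqr_ge0 (s + (s + b z z)); nra.
Qed.

Lemma riesz : exists w, forall z, inner w z = phi z.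
Proof.
have xk_d (d : R) : 0 < d -> exists N, forall n, (N <= n)%N -> J (x n) <= m + d.
  move=> d0.
  exists (Num.truncn d^-1) => n Nn; apply: (le_trans (ltW (xP n))).
  rewrite lerD2l invf_ple ?posrE//; apply: ltW; apply: lt_le_trans (truncnS_gt _) _.
  by rewrite ler_nat.
have [|w wP] := @inner_complete R H x.
  move=> e e0; have d0 : 0 < e ^+ 2 / 8 by rewrite divr_gt0// exprn_gt0.
  have [N hN] := xk_d _ d0; exists N => i j iN jN.
  rewrite -/(hnorm _) -ltr_sqr ?nnegrE ?hnorm_ge0 ?ltW// hnorm_sqr.
  apply: le_lt_trans (x_cauchy (ltW d0) (hN _ iN) (hN _ jN)) _.
  by nra.
exists w; suff wr z : b w z = r z.
  by move=> z; apply: qre_sep => q; rewrite -innerZr -phiZ; exact: wr.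
apply/eqP; rewrite -subr_eq0 -sqrf_eq0 eq_le sqr_ge0 andbT.
apply/ler_addgt0Pl => e e0; rewrite addr0.
pose n := b z z; have n0 : 0 <= n by exact: re_ge0.
pose d := e / (4 * (n + 1)).
have d0 : 0 < d by rewrite divr_gt0// mulr_gt0// ltr_wpDl.
have [N1 h1] := xk_d _ d0; have [N2 h2] := wP d d0.
have [N3 h3] := wP 1 ltr01.
pose k := maxn N1 (maxn N2 N3).
have {}h1 := near_opt z (ltW d0) (h1 k (leq_maxl _ _)).
have {}h2 := h2 k (leq_trans (leq_maxl _ _) (leq_maxr _ _)).
have {}h3 := h3 k (leq_trans (leq_maxr _ _) (leq_maxr _ _)).
have nd : b (x k - w) (x k - w) <= d.
  rewrite /b -hnorm_sqr; have := hnorm_ge0 (x k - w).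
  by move: h2 h3; rewrite -/(hnorm _) => h2 h3 h0; nra.
have cs := reCS (x k - w) z.
have e1 : b (x k) z = b w z + b (x k - w) z by rewrite /b -reDl addrC subrK.
have dn : d * n <= e / 4.
  by rewrite /d mulrAC ler_pdivrMr ?mulr_gt0 ?ltr_wpDl//; nra.
move: h1 cs; rewrite e1 -/(b _ _) -/(b _ _) -/n => h1 cs.
have cs' : b (x k - w) z ^+ 2 <= d * n by apply: le_trans cs _; rewrite ler_wpM2r.
set p := b w z - r z; set q := b (x k - w) z in h1 cs'.
have : (p + q) ^+ 2 <= d * n.
  by apply: le_trans h1; rewrite le_eqVlt; apply/orP; left; apply/eqP; rewrite /p; ring.
by have := sqr_ge0 (p + q + q); nra.
Qed.
End Riesz.

Section Adjoint.
Variables (R : realType) (H : rqHilbertType R).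

Lemma adjoint_exists (L : bop H) :
  exists M : bop H, forall u v, inner (M u) v = inner u (L v).
Proof.
have [C hC] := op_bounded L.
have ex u : exists w, forall v, inner w v = inner u (L v).
  apply: (@riesz R H (fun v => inner u (L v)) _ _ (hnorm u * C)).
  - by move=> v w; rewrite linearD innerDr.
  - by move=> v q; rewrite /rscale linearZ/= -/(rscale _ _) innerZr.
  - move=> v; apply: le_trans (re_le_norm _ _) _.
    by rewrite -mulrA ler_wpM2l ?hnorm_ge0.
pose M u := sval (cid (ex u)).
have MP u v : inner (M u) v = inner u (L v) by exact: (svalP (cid (ex u))).
have Mlin : linear M.
  move=> a u v; apply/eqP; rewrite -subr_eq0; apply/eqP/inner_sep => w.
  rewrite innerDl innerNl -/(rscale u a) -/(rscale (M u) a).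
  by rewrite MP !innerDl !innerZl !MP subrr.
pose Ml := GRing.isLinear.Build _ _ _ _ M Mlin.
pose MM : {linear H -> H} := HB.pack M Ml.
have Mb : bounded_op MM.
  exists C => u; rewrite -[MM u]/(M u).
  have [M0|M0] := eqVneq (hnorm (M u)) 0.
    by rewrite M0; apply: le_trans (hC u); exact: hnorm_ge0.
  have Mp : 0 < hnorm (M u) by rewrite lt_neqAle eq_sym M0 hnorm_ge0.
  rewrite -(ler_pM2r Mp) -expr2 hnorm_sqr MP.
  apply: le_trans (ler_norm _) _; apply: le_trans (re_le_norm _ _) _.
  by rewrite -mulrA mulrCA ler_wpM2l ?hnorm_ge0.
by exists (Bop Mb).
Qed.

Definition adjoint (L : bop H) : bop H := sval (cid (adjoint_exists L)).

Lemma adjointE (L : bop H) u v : inner (adjoint L u) v = inner u (L v).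
Proof. exact: (svalP (cid (adjoint_exists L))). Qed.
End Adjoint.

Section DirectSum.
Variables (R : realType) (H1 H2 : rqHilbertType R).

Definition dsum_inner (p q : H1 * H2) : quat R :=
  inner p.1 q.1 + inner p.2 q.2.

Lemma dsum_inner_conj p q : dsum_inner p q = qconj (dsum_inner q p).
Proof. by rewrite /dsum_inner qconjD -!inner_conj. Qed.

Lemma dsum_inner_gt0 p : p != 0 -> 0 < qre (dsum_inner p p).
Proof.
case: p => u v; rewrite /dsum_inner qreD /=.
have [->|u0 _] := eqVneq u 0; last by rewrite ltr_pwDl ?inner_gt0 ?re_ge0.
have [->|v0 _] := eqVneq v 0; first by rewrite eqxx.
by rewrite ltr_wpDl ?inner_gt0 ?re_ge0.
Qed.

Lemma dsum_innerDr p q r :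
  dsum_inner p (q + r) = dsum_inner p q + dsum_inner p r.
Proof. by rewrite /dsum_inner /= !innerDr addrACA. Qed.

Lemma dsum_innerZr p q a : dsum_inner p (rscale q a) = dsum_inner p q * a.
Proof.
rewrite /dsum_inner mulrDl -!innerZr.
by [].
Qed.

Let dnorm_sqr p :
  ip_norm dsum_inner p ^+ 2 = hnorm p.1 ^+ 2 + hnorm p.2 ^+ 2.
Proof.
rewrite !hnorm_sqr /ip_norm sqr_sqrtr//.
by rewrite /dsum_inner qreD addr_ge0 ?re_ge0.
Qed.

Let fst_le p : hnorm p.1 <= ip_norm dsum_inner p.
Proof.
rewrite -ler_sqr ?nnegrE ?hnorm_ge0 ?sqrtr_ge0// dnorm_sqr.
by rewrite lerDl sqr_ge0.
Qed.

Let snd_le p : hnorm p.2 <= ip_norm dsum_inner p.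
Proof.
rewrite -ler_sqr ?nnegrE ?hnorm_ge0 ?sqrtr_ge0// dnorm_sqr.
by rewrite lerDr sqr_ge0.
Qed.

Lemma dsum_complete (x : nat -> H1 * H2) :
  (forall e : R, 0 < e -> exists N : nat, forall m n : nat,
     (N <= m)%N -> (N <= n)%N -> ip_norm dsum_inner (x m - x n) < e) ->
  exists l : H1 * H2, forall e : R, 0 < e -> exists N : nat, forall n : nat,
     (N <= n)%N -> ip_norm dsum_inner (x n - l) < e.
Proof.
move=> xC.
have [|l1 h1] := @inner_complete R H1 (fun n => (x n).1).
  move=> e /xC[N hN]; exists N => m n Nm Nn.
  by apply: le_lt_trans (hN m n Nm Nn); exact: (fst_le (x m - x n)).
have [|l2 h2] := @inner_complete R H2 (fun n => (x n).2).
  move=> e /xC[N hN]; exists N => m n Nm Nn.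
  by apply: le_lt_trans (hN m n Nm Nn); exact: (snd_le (x m - x n)).
exists (l1, l2) => e e0; have e2 : 0 < e / 2 by rewrite divr_gt0.
have [N1 {}h1] := h1 _ e2; have [N2 {}h2] := h2 _ e2.
exists (maxn N1 N2) => n; rewrite geq_max => /andP[/h1 + /h2].
rewrite -!/(hnorm _) => a1 a2.
rewrite -ltr_sqr ?nnegrE ?sqrtr_ge0 ?ltW// dnorm_sqr /=.
have := hnorm_ge0 ((x n).1 - l1); have := hnorm_ge0 ((x n).2 - l2).
by nra.
Qed.

HB.instance Definition _ := isRQHilbert.Build R (H1 * H2)%type
  dsum_inner_conj dsum_inner_gt0 dsum_innerDr dsum_innerZr dsum_complete.

Variables (K1 : bop H1) (K2 : bop H2).

Definition dsum_fun (p : H1 * H2) : H1 * H2 := (K1 p.1, K2 p.2).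

Lemma dsum_fun_linear : linear dsum_fun.
Proof. by move=> a p q; rewrite /dsum_fun /= !linearP. Qed.

HB.instance Definition _ :=
  GRing.isLinear.Build _ _ _ _ dsum_fun dsum_fun_linear.

Lemma dsum_fun_bounded : bounded_op dsum_fun.
Proof.
have [C1 h1] := op_bounded K1; have [C2 h2] := op_bounded K2.
exists (`|C1| + `|C2|) => p.
have C0 : 0 <= `|C1| + `|C2| by rewrite addr_ge0.
rewrite -ler_sqr ?nnegrE ?mulr_ge0 ?hnorm_ge0// exprMn.
rewrite !(dnorm_sqr : forall p, hnorm p ^+ 2 = _) /=.
have le1 (C D x y : R) : 0 <= x -> 0 <= y -> y <= C * x ->
    y ^+ 2 <= (`|C| + `|D|) ^+ 2 * x ^+ 2.
  move=> x0 y0 yC; rewrite -exprMn ler_sqr ?nnegrE ?mulr_ge0 ?addr_ge0//.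
  apply: le_trans yC _; apply: ler_wpM2r => //.
  by apply: le_trans (ler_norm _) _; rewrite lerDl.
rewrite mulrDr lerD//; first by apply: le1; rewrite ?hnorm_ge0.
by rewrite addrC; apply: le1; rewrite ?hnorm_ge0.
Qed.

Definition dsum_op : bop (H1 * H2)%type := Bop dsum_fun_bounded.
End DirectSum.

#[global] Existing Instance summability.totally_filter.

Section UnorderedSum.
Variables (R : realType) (I : choiceType).
Implicit Types f g : I -> R.

Let psumE f (A : {fset I}) :
  (summability.partial_sum f A)%:E = (\sum_(i \in [set` A]) (f i)%:E)%E.
Proof.
by rewrite fsbig_finite//= set_fsetK sumEFin /summability.partial_sum
  big_seq_fsetE.
Qed.

Lemma partial_sum_cvg_ge0 f : (forall i, 0 <= f i) ->
  (\esum_(i in [set: I]) (f i)%:E < +oo)%E ->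
  summability.partial_sum f @ summability.totally -->
    (fine (\esum_(i in [set: I]) (f i)%:E) : R^o).
Proof.
move=> f0 foo; set S := esum _ _ in foo *.
have Sfin : S \is a fin_num.
  by rewrite ge0_fin_numE// esum_ge0// => i _; rewrite lee_fin.
apply/cvgrPdist_lt => e e0.
have [_ [A [Afin _] <-] hA] := ub_ereal_sup_adherent e0 Sfin.
exists (fset_set A) => //= B AB.
have hB : ((summability.partial_sum f B)%:E <= S)%E.
  by rewrite psumE; apply: esum_ge; exists [set` B]; [split|].
have hAB : ((\sum_(i \in A) (f i)%:E) <= (summability.partial_sum f B)%:E)%E.
  rewrite psumE; apply: lee_fsum_nneg_subset => //.
    by move=> i; rewrite !inE => Ai; apply: (fsubsetP AB); rewrite in_fset_set// inE.
  by move=> i _; rewrite lee_fin.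
have := lt_le_trans hA hAB; rewrite -[ereal_sup _]/S.
move: hB; rewrite -(fineK Sfin) -EFinB lte_fin lee_fin /= => h1 h2.
by rewrite ger0_norm ?subr_ge0//; lra.
Qed.

Lemma partial_sum_is_cvg f :
  (\esum_(i in [set: I]) `|f i|%:E < +oo)%E ->
  cvg (summability.partial_sum f @ summability.totally : set_system R^o).
Proof.
move=> foo.
have h s : (s = 1 \/ s = -1) -> cvg (summability.partial_sum
    (fun i => (`|f i| + s * f i)) @ summability.totally : set_system R^o).
  move=> s1; have ge0 i : 0 <= `|f i| + s * f i.
    have := ler_norm (f i); have := ler_norm (- f i); rewrite normrN.
    by case: s1 => ->; lra.
  apply: cvgP; apply: partial_sum_cvg_ge0 => //.
  apply: (@le_lt_trans _ _ (\esum_(i in [set: I]) (`|f i|%:E + `|f i|%:E))%E).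
    apply: le_esum => i _; rewrite -EFinD lee_fin.
    have := ler_norm (f i); have := ler_norm (- f i); rewrite normrN.
    by case: s1 => ->; lra.
  by rewrite esumD; [exact: lte_add_pinfty|by []..].
have -> : summability.partial_sum f = (fun A => 2^-1 *
    (summability.partial_sum (fun i => `|f i| + 1 * f i) A -
     summability.partial_sum (fun i => `|f i| + (-1) * f i) A)).
  apply/funext => A; rewrite /summability.partial_sum -sumrB mulr_sumr.
  by apply: eq_bigr => i _; field.
apply: (@is_cvgZr R R^o); apply: (@is_cvgB R R^o).
  by apply: h; left.
by apply: h; right.
Qed.
End UnorderedSum.

Section Ell2.
Variables (R : realType) (I : countType).

Definition square_summable (q : I -> quat R) :=
  (\esum_(i in [set: I]) (qabs (q i) ^+ 2)%:E < +oo)%E.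

Record ell2 := Ell2 {
  ell2_fun :> I -> quat R;
  ell2P : square_summable ell2_fun
}.

(* summability.sum is the limit of the sums over finite subsets of I. *)
Definition rsum (f : I -> R) : R := summability.sum (f : I -> R^o).

Definition qsum (f : I -> quat R) : quat R :=
  Quat (rsum (fun i => qre (f i))) (rsum (fun i => qi (f i)))
       (rsum (fun i => qj (f i))) (rsum (fun i => qk (f i))).

Definition ell2_inner (p q : ell2) : quat R := qsum (fun i => qconj (p i) * q i).

Lemma ell2_inner_cvg (p q : ell2) (c : quat R -> R) :
  (forall x, `|c x| <= qabs x) ->
  cvg (summability.partial_sum (fun i => c (qconj (p i) * q i))
         @ summability.totally : set_system R^o).
Proof.
move=> cle; apply: partial_sum_is_cvg.
apply: (@le_lt_trans _ _ (\esum_(i in [set: I])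
    ((qabs (p i) ^+ 2)%:E + (qabs (q i) ^+ 2)%:E))%E); last first.
  rewrite esumD; first exact: lte_add_pinfty (ell2P p) (ell2P q).
    by move=> i _; rewrite lee_fin sqr_ge0.
  by move=> i _; rewrite lee_fin sqr_ge0.
apply: le_esum => i _; rewrite -EFinD lee_fin.
apply: le_trans (cle _) _.
have e : qabs (qconj (p i) * q i) = qabs (p i) * qabs (q i).
  apply/eqP; rewrite -(@eqrXn2 _ 2) ?mulr_ge0 ?sqrtr_ge0//.
  by rewrite exprMn !qabs_sqr; apply/eqP => /=; ring.
rewrite e.
have := sqrtr_ge0 (qre (p i) ^+ 2 + qi (p i) ^+ 2 + qj (p i) ^+ 2 + qk (p i) ^+ 2).
have := sqrtr_ge0 (qre (q i) ^+ 2 + qi (q i) ^+ 2 + qj (q i) ^+ 2 + qk (q i) ^+ 2).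
by rewrite -!/(qabs _) => h1 h2; nra.
Qed.

Definition ell2_orthogonal (A B : set ell2) :=
  forall p q, A p -> B q -> ell2_inner p q = 0.
End Ell2.

Section Frames.
Variables (R : realType) (I : countType) (H : rqHilbertType R).

Definition Kframe (K : bop H) (w : I -> H) :=
  exists A B : R, [/\ 0 < A, A <= B & forall u : H,
    ((A * hnorm (adjoint K u) ^+ 2)%:E
       <= \esum_(i in [set: I]) (qabs (inner (w i) u) ^+ 2)%:E
       <= (B * hnorm u ^+ 2)%:E)%E].

Lemma Kframe_square_summable (K : bop H) (w : I -> H) (u : H) :
  Kframe K w -> square_summable (fun i => inner (w i) u).
Proof.
by move=> [A [B [_ _ /(_ u)/andP[_ h]]]]; apply: le_lt_trans h (ltry _).
Qed.

Definition frame_transform (K : bop H) (w : I -> H) (hw : Kframe K w) (u : H) :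
  ell2 R I := Ell2 (Kframe_square_summable u hw).
End Frames.

(* Main.v *)
Require Import Defs.
From mathcomp Require Import all_boot all_order all_algebra.
From mathcomp Require Import boolp classical_sets reals.
From mathcomp Require Import ereal topology normedtype esum.
From mathcomp.analysis.showcase Require summability.
From mathcomp Require Import ring lra.

(** Write p = theta_1 a and q = theta_2 b.  The coefficient of a + b against
    u_i + v_i is p_i + q_i, so the frame sum of the direct sum family is the
    squared l^2 norm of p + q.  Orthogonality of the two ranges and Pythagoras
    ([ell2_pythagoras]) split it into the two separate frame sums, and as the
    adjoint of K_1 + K_2 also acts componentwise ([adjoint_dsum]), adding the
    two pairs of frame inequalities gives bounds min(A_1, A_2) and
    max(B_1, B_2).

    The delicate point is Pythagoras: squared norms are sums of extended
    nonnegative reals, while the inner product is a limit of signed real sums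
    along the finite subsets of I.  The expansion
    |p_i + q_i|^2 = |p_i|^2 + |q_i|^2 + 2 Re(conj(p_i) q_i) is therefore summed
    along finite subsets and limits are compared there, which first needs
    that p + q is square summable. *)

Import Order.TTheory GRing.Theory Num.Theory numFieldNormedType.Exports.

Local Open Scope classical_set_scope.
Local Open Scope ring_scope.

Lemma qabs_sqrD (R : realType) (p q : quat R) :
  qabs (p + q) ^+ 2 = qabs p ^+ 2 + qabs q ^+ 2 + 2 * qre (qconj p * q).
Proof. by rewrite !qabs_sqr /=; ring. Qed.

Lemma qre_le_qabs (R : realType) (q : quat R) : `|qre q| <= qabs q.
Proof.
rewrite -ler_sqr ?nnegrE ?normr_ge0 ?sqrtr_ge0// real_normK ?num_real//.
rewrite qabs_sqr -!addrA lerDl.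
by rewrite !addr_ge0 ?sqr_ge0.
Qed.

Lemma square_summableD (R : realType) (I : countType) (p q : ell2 R I) :
  square_summable (fun i => p i + q i).
Proof.
have sq0 (r : I -> quat R) i : (0 <= (qabs (r i) ^+ 2)%:E)%E.
  by rewrite lee_fin sqr_ge0.
(* |p_i + q_i|^2 <= 2 |p_i|^2 + 2 |q_i|^2, by the parallelogram law *)
apply: (@le_lt_trans _ _ (\esum_(i in [set: I])
    (((qabs (p i) ^+ 2)%:E + (qabs (q i) ^+ 2)%:E) +
     ((qabs (p i) ^+ 2)%:E + (qabs (q i) ^+ 2)%:E)))%E).
  apply: le_esum => i _; rewrite -!EFinD lee_fin.
  have := qabs_sqrD _ (p i) (- q i); have := qabs_sqrD _ (p i) (q i).
  have := sqr_ge0 (qabs (p i - q i)).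
  by rewrite !qabs_sqr /=; nra.
rewrite !esumD => [|i _|i _|i _|i _]; rewrite ?adde_ge0 ?sq0//.
by rewrite !lte_add_pinfty//; exact: ell2P.
Qed.

(** Over each finite subset of I the two sides differ by twice the partial sum
    of Re(conj(p_i) q_i); these partial sums tend to the real part of the inner
    product, so orthogonality makes the difference vanish in the limit. *)
Lemma ell2_pythagoras (R : realType) (I : countType) (p q : ell2 R I) :
  qre (ell2_inner p q) = 0 ->
  (\esum_(i in [set: I]) (qabs (p i + q i) ^+ 2)%:E =
   \esum_(i in [set: I]) (qabs (p i) ^+ 2)%:E +
   \esum_(i in [set: I]) (qabs (q i) ^+ 2)%:E)%E.
Proof.
move=> pq0.
have sumfin (r : I -> quat R) : square_summable r ->
    (\esum_(i in [set: I]) (qabs (r i) ^+ 2)%:E)%E \is a fin_num.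
  by move=> rs; rewrite ge0_fin_numE// esum_ge0// => i _; rewrite lee_fin sqr_ge0.
have sumcvg (r : I -> quat R) (rs : square_summable r) :=
  @partial_sum_cvg_ge0 R I (fun i => qabs (r i) ^+ 2)
    (fun i => sqr_ge0 _) rs.
have pqs := square_summableD _ _ p q.
have cross : summability.partial_sum (fun i => qre (qconj (p i) * q i))
    @ summability.totally --> (0 : R^o).
  rewrite -[X in _ --> X]pq0; apply: ell2_inner_cvg.
  exact: qre_le_qabs.
have pqcvg : summability.partial_sum (fun i => qabs (p i + q i) ^+ 2)
    @ summability.totally -->
    (fine (\esum_(i in [set: I]) (qabs (p i) ^+ 2)%:E)%E +
     fine (\esum_(i in [set: I]) (qabs (q i) ^+ 2)%:E)%E + 2 * 0 : R^o).
  have -> : summability.partial_sum (fun i => qabs (p i + q i) ^+ 2) =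
      (fun A => summability.partial_sum (fun i => qabs (p i) ^+ 2) A +
         summability.partial_sum (fun i => qabs (q i) ^+ 2) A +
         2 * summability.partial_sum (fun i => qre (qconj (p i) * q i)) A).
    apply/funext => A; rewrite /summability.partial_sum mulr_sumr -!big_split /=.
    by apply: eq_bigr => i _; exact: qabs_sqrD.
  apply: (@cvgD R R^o); last exact: (@cvgM R _ _ _ _ _ _ _ (cvg_cst _) cross).
  by apply: (@cvgD R R^o); apply: sumcvg; exact: ell2P.
have := @cvg_unique R^o (@norm_hausdorff _ _) _ _ _ _ (sumcvg _ pqs) pqcvg.
rewrite mulr0 addr0 => e.
rewrite -(fineK (sumfin _ pqs)) e EFinD !fineK//; apply: sumfin; exact: ell2P.
Qed.

Lemma adjoint_dsum (R : realType) (H1 H2 : rqHilbertType R)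
    (K1 : bop H1) (K2 : bop H2) (p : H1 * H2) :
  adjoint (dsum_op K1 K2) p = (adjoint K1 p.1, adjoint K2 p.2).
Proof.
apply/eqP; rewrite -subr_eq0; apply/eqP/inner_sep => w.
rewrite innerDl innerNl adjointE.
have -> : inner (adjoint K1 p.1, adjoint K2 p.2) w =
    inner (adjoint K1 p.1) w.1 + inner (adjoint K2 p.2) w.2 by [].
by rewrite !adjointE subrr.
Qed.

Lemma hnorm_dsum_sqr (R : realType) (H1 H2 : rqHilbertType R) (p : H1 * H2) :
  hnorm p ^+ 2 = hnorm p.1 ^+ 2 + hnorm p.2 ^+ 2.
Proof. by rewrite !hnorm_sqr. Qed.

Theorem theorem12 (R : realType) (I : countType) (H1 H2 : rqHilbertType R)
  (K1 : bop H1) (K2 : bop H2) (u : I -> H1) (v : I -> H2)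
  (hu : Kframe K1 u) (hv : Kframe K2 v) :
  ell2_orthogonal (range (frame_transform hu)) (range (frame_transform hv)) ->
  Kframe (dsum_op K1 K2) (fun i : I => (u i, v i)).
Proof.
move=> orth.
have [A1 [B1 [A1_gt0 AB1 h1]]] := hu.
have [A2 [B2 [A2_gt0 AB2 h2]]] := hv.
exists (Num.min A1 A2), (Num.max B1 B2); split.
- by rewrite lt_min A1_gt0.
- by rewrite ge_min le_max AB1.
move=> p; rewrite adjoint_dsum !hnorm_dsum_sqr.
have frame_sum : (\esum_(i in [set: I]) (qabs (inner (u i, v i) p) ^+ 2)%:E =
    \esum_(i in [set: I]) (qabs (inner (u i) p.1) ^+ 2)%:E +
    \esum_(i in [set: I]) (qabs (inner (v i) p.2) ^+ 2)%:E)%E.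
  apply: (@ell2_pythagoras _ _ (frame_transform hu p.1) (frame_transform hv p.2)).
  by rewrite orth.
have /andP[l1 r1] := h1 p.1; have /andP[l2 r2] := h2 p.2.
rewrite frame_sum !mulrDr !EFinD; apply/andP; split.
- apply: le_trans (leeD l1 l2).
  by rewrite leeD// lee_fin ler_wpM2r ?sqr_ge0// ge_min lexx ?orbT.
- apply: le_trans (leeD r1 r2) _.
  by rewrite leeD// lee_fin ler_wpM2r ?sqr_ge0// le_max lexx ?orbT.
Qed.
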